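(* In the setting of the context, let $\widehat\zeta\neq\zeta$ be an approximation to $\zeta$, let the terminal values of the backward recurrence satisfy $\lambda_Np_N\widehat\varphi_N^N\to0$ as $N\to\infty$, and let $\widetilde\varphi_n^N$, $\widetilde b_n^N$ be the mixed forward--backward approximations. Assume relative errors are well defined, i.e. $\zeta$, $\varphi_n$, $b_n$ are nonzero wherever they appear as denominators. Then, for each $n$, as $N\to\infty$: (a) $E_{\mathrm{abs}}(\widetilde\varphi_n^N)\to A_n\,E_{\mathrm{abs}}(\widehat\zeta)$; (b) $E_{\mathrm{rel}}(\widetilde\varphi_n^N)\to \frac{\zeta A_n}{\varphi_n}E_{\mathrm{rel}}(\widehat\zeta)$; (c) $E_{\mathrm{abs}}(\widetilde b_n^N)\to B_n\,E_{\mathrm{abs}}(\widehat\zeta)$; (d) $E_{\mathrm{rel}}(\widetilde b_n^N)\to \frac{\zeta B_n}{b_n}E_{\mathrm{rel}}(\widehat\zeta)$.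
   Context: Let $\{X(t)\}_{t\ge 0}$ be a continuous-time birth--death Markov chain on $\mathbb{N}_0=\{0,1,2,\dots\}$ with birth rates $\lambda_n>0$ ($n\ge 0$), death rates $\mu_n>0$ ($n\ge 1$) and $\mu_0=0$. Set $\pi_0=1$, $\pi_n=\frac{\lambda_0\cdots\lambda_{n-1}}{\mu_1\cdots\mu_n}$ for $n\ge1$. Standing assumption: $\sum_{n\ge 0} 1/(\lambda_n\pi_n)=\infty$ and $\sum_{n\ge 0}\pi_n<\infty$ (the process is uniquely determined by its rates and ergodic). The steady-state probabilities are $p_n=\pi_n/\sum_{j\ge 0}\pi_j$. Cost rates $c_n\in\mathbb{R}$ satisfy $\sum_n |c_n|p_n<\infty$, and $\zeta:=\sum_n c_np_n$. $P_n:=\sum_{j=0}^n p_j$ and $\bar P_n:=1-P_n$. With $\tau_n:=\min\{t\ge 0: X(t)=n\}$ and $\mathbb{E}_n$ the expectation given $X(0)=n$: $T_n^+:=\mathbb{E}_n[\tau_{n+1}]$, $T_{n+1}^-:=\mathbb{E}_{n+1}[\tau_n]$, $T_{0n}:=\mathbb{E}_0[\tau_n]$, $T_{n0}:=\mathbb{E}_n[\tau_0]$ (so $T_{00}=0$). For $z\in\mathbb{R}$ let $f_0(z)=\frac{z-c_0}{\lambda_0}$, $f_n(z)=\frac{z-c_n}{\lambda_n}+\frac{\mu_n}{\lambda_n}f_{n-1}(z)$, $n\ge 1$. Exact quantities: $\varphi_n:=f_n(\zeta)$, $b_n:=b_0+\sum_{j=0}^{n-1}\varphi_j$ with $b_0$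 given. Forward recurrence: $\widehat\varphi_n:=f_n(\widehat\zeta)$, $\widehat b_n:=b_0+\sum_{j=0}^{n-1}\widehat\varphi_j$. Backward recurrence: given $\widehat\varphi_N^N\in\mathbb{R}$, $\widehat\varphi_{n-1}^N=\frac{c_n-\widehat\zeta}{\mu_n}+\frac{\lambda_n}{\mu_n}\widehat\varphi_n^N$ for $n=N,\dots,1$; $\widehat b_0^N=b_0$, $\widehat b_n^N=b_0+\sum_{j=0}^{n-1}\widehat\varphi_j^N$. Mixed scheme (for $n<N$): $\widetilde\varphi_n^N:=\widehat\varphi_n$ if $P_n\le\bar P_n$ and $\widetilde\varphi_n^N:=\widehat\varphi_n^N$ otherwise; $\widetilde b_n^N:=\widehat b_n$ if $T_{0n}\le T_{n0}$ and $\widetilde b_n^N:=\widehat b_n^N$ otherwise. Let $m:=\min\{n\ge 0:\bar P_n/P_n<1\}$ and $M:=\min\{n\ge 1:T_{n0}/T_{0n}<1\}$ (both exist; $P_n\le\bar P_n$ iff $n<m$, and $T_{0n}\le T_{n0}$ iff $n<M$). Define $A_n:=T_n^+$ if $n<m$, $A_n:=-T_{n+1}^-$ otherwise; $B_n:=T_{0n}$ if $n<M$, $B_n:=-T_{n0}$ otherwise. For an approximation $\widehat x$ to $x$: $E_{\mathrm{abs}}(\widehat x):=\widehat x-x$, $E_{\mathrm{rel}}(\widehat x):=E_{\mathrm{abs}}(\widehat x)/x$ (if $x\neq0$). *)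

(* Defs.v *)
From HB Require Import structures.
From mathcomp Require Import all_boot all_order all_algebra.
From mathcomp Require Import all_classical all_reals all_analysis.

Set Implicit Arguments.
Unset Strict Implicit.
Unset Printing Implicit Defensive.

Import Order.TTheory GRing.Theory Num.Theory.
Import numFieldNormedType.Exports.

Local Open Scope classical_set_scope.
Local Open Scope ring_scope.

(* If S is empty, this is the junk value 0. *)
Definition least (S : set nat) : nat :=
  xget 0%N [set n | S n /\ forall k, S k -> (n <= k)%N].

Section Rates.
Context {R : realType}.
Variables lam mu c : nat -> R.

Definition potential (n : nat) : R :=
  \prod_(i < n) lam i / \prod_(i < n) mu i.+1.

Definition steady (n : nat) : R := potential n / limn (series potential).

Definition steady_cdf (n : nat) : R := \sum_(j < n.+1) steady j.

Definition steady_tail (n : nat) : R := 1 - steady_cdf n.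

Definition mean_cost : R := limn (series (fun n => c n * steady n)).

Fixpoint forward (z : R) (n : nat) : R :=
  match n with
  | 0 => (z - c 0%N) / lam 0%N
  | k.+1 => (z - c k.+1) / lam k.+1 + mu k.+1 / lam k.+1 * forward z k
  end.

(* [phiN N n] is the n-th term of the backward recurrence started from the
   terminal value [phiN N N]; the entries with N < n are irrelevant. *)
Definition backward_recurrence (z : R) (phiN : nat -> nat -> R) : Prop :=
  forall N n : nat, (1 <= n <= N)%N ->
    phiN N n.-1 = (c n - z) / mu n + lam n / mu n * phiN N n.

Definition bias (b0 : R) (phi : nat -> R) (n : nat) : R :=
  b0 + \sum_(j < n) phi j.

Definition mixed_phi (z : R) (phiN : nat -> nat -> R) (N n : nat) : R :=
  if steady_cdf n <= steady_tail n then forward z n else phiN N n.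

Definition split_phi : nat :=
  least [set n | steady_tail n / steady_cdf n < 1].

End Rates.

Section Process.
Context {R : realType} {d : measure_display} {Omega : measurableType d}.
(* [Pr i] is the law of the process given X(0) = i. Only times t >= 0 matter. *)
Variables (Pr : nat -> probability Omega R) (X : R -> Omega -> nat).

(* Time-homogeneous Markov chain on nat with right-continuous paths and
   infinitesimal transition probabilities
     p_{n,n+1}(h) = lam_n h + o(h), p_{n,n-1}(h) = mu_n h + o(h),
     p_{n,n}(h) = 1 - (lam_n + mu_n) h + o(h)   as h -> 0+. *)
Record birth_death_chain (lam mu : nat -> R) : Prop := BirthDeathChain {
  bd_measurable : forall t : R, 0 <= t -> measurable_fun [set: Omega] (X t);
  bd_right_continuous : forall (w : Omega) (t : R), 0 <= t ->
    \forall s \near t^'+, X s w = X t w;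
  bd_start : forall i : nat, Pr i [set w | X 0 w = i] = 1%E;
  bd_markov : forall (i k : nat) (t : nat -> R) (x : nat -> nat) (s : R)
      (y : nat),
    0 <= t 0%N -> (forall j, (j < k)%N -> t j <= t j.+1) -> 0 <= s ->
    Pr i ([set w | forall j, (j <= k)%N -> X (t j) w = x j]
          `&` [set w | X (t k + s) w = y])
    = (Pr i [set w | forall j, (j <= k)%N -> X (t j) w = x j]
       * Pr (x k) [set w | X s w = y])%E;
  bd_birth : forall n : nat,
    fine (Pr n [set w | X h w = n.+1]) / h @[h --> 0^'+] --> lam n;
  bd_death : forall n : nat, (1 <= n)%N ->
    fine (Pr n [set w | X h w = n.-1]) / h @[h --> 0^'+] --> mu n;
  bd_stay : forall n : nat,
    (1 - fine (Pr n [set w | X h w = n])) / h @[h --> 0^'+] --> lam n + mu n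
}.

Definition hitting_time (n : nat) (w : Omega) : \bar R :=
  ereal_inf [set t%:E | t in [set t : R | 0 <= t /\ X t w = n]].

Local Open Scope ereal_scope.

(* E_i[tau_n] *)
Definition mean_hitting (i n : nat) : \bar R :=
  \int[Pr i]_w hitting_time n w.

Definition coef_A (lam mu : nat -> R) (n : nat) : \bar R :=
  if (n < split_phi lam mu)%N then mean_hitting n n.+1
  else - mean_hitting n.+1 n.

Definition split_b : nat :=
  least [set n | (1 <= n)%N /\ mean_hitting n 0 / mean_hitting 0 n < 1].

Definition coef_B (n : nat) : \bar R :=
  if (n < split_b)%N then mean_hitting 0 n else - mean_hitting n 0.

Definition mixed_b (lam mu c : nat -> R) (b0 z : R) (phiN : nat -> nat -> R)
    (N n : nat) : R :=
  if mean_hitting 0 n <= mean_hitting n 0 then bias b0 (forward lam mu c z) n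
  else bias b0 (phiN N) n.

End Process.

Definition abs_err {R : realType} (xh x : R) : R := xh - x.
Definition rel_err {R : realType} (xh x : R) : R := abs_err xh x / x.

(* Main.v *)
(** Write p for the steady-state law. Balance gives
    lam_n p_n f_n(z) = sum_(j <= n) p_j (z - c_j), and the backward recurrence
    satisfies the same identity with the complementary sum over j > n, up to the
    terminal term. Hence the forward error is P_n / (lam_n p_n) times the error on
    zeta, and the limit of the backward error is - (1 - P_n) / (lam_n p_n) times it.

    It remains to identify these factors with mean hitting times of the chain.
    Sample the chain on the grid of step h = 2^-k. If g_i(l) is the probability that
    the target is avoided at times 0, h, ..., l h from state i, the Markov property
    gives g_i(l+1) = sum_y p_iy(h) g_y(l), so that S_i = h sum_(l < m) g_i(l) satisfies
    |S_i + h g_i(m) - h - sum_y p_iy(h) S_y| <= m h (1 - sum_y p_iy(h)),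
    with y ranging over i and its neighbours. Dividing by h and letting k grow with
    m h = T fixed, the right-hand side vanishes and, by right-continuity of the paths,
    S_i tends to U_i = E_i[min(tau, T)]. Thus
    u_i = 1 - (lam_i + mu_i) U_i + lam_i U_(i+1) + mu_i U_(i-1)
    lies in [0, 1] and T u_i <= U_i. Telescoping these equations expresses the
    increments of U by sums of p_j (1 - u_j); for downward passages the boundary term
    at infinity vanishes because 0 <= U <= T while sum 1 / (lam_n p_n) diverges. Since U
    is then bounded in T, u tends to 0 as T grows, which yields the formulas. *)

Require Import Defs.
From HB Require Import structures.
From mathcomp Require Import all_boot all_order all_algebra.
From mathcomp Require Import all_classical all_reals all_analysis.
From mathcomp Require Import measurable_realfun ring lra zify.

Import Order.TTheory GRing.Theory Num.Theory.
Import numFieldNormedType.Exports.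

Local Open Scope classical_set_scope.
Local Open Scope ring_scope.

(** * Least elements and limits of finite sums *)

(** Nonemptiness excludes the junk value of [least], and upward closure makes everything outside [S]
    lie below its minimum. This links the inequalities that steer the mixed scheme to [split_phi]
    and [split_b]. *)
Lemma lt_least (S : set nat) (n : nat) :
  (forall k l, (k <= l)%N -> S k -> S l) -> (exists k, S k) ->
  (n < least S)%N <-> ~ S n.
Proof.
move=> Sup [k Sk]; have [l Sl lmin] : exists2 l, S l & forall j, S j -> (l <= j)%N.
  have exS : exists k, `[< S k >] by exists k; apply/asboolP.
  case: (ex_minnP exS) => l /asboolP Sl lmin.
  by exists l => // j /asboolP; apply: lmin.
have -> : least S = l.
  apply: xget_subset1 => // i j [Si imin] [Sj jmin].
  by apply/eqP; rewrite eqn_leq imin// jmin.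
split=> [nl /lmin|nSn]; first by rewrite leqNgt nl.
by rewrite ltnNge; apply/negP => ln; apply: nSn; apply: Sup Sl.
Qed.

Lemma cvg_sum_nat {R : realType} (F : nat -> nat -> R) (l : nat -> R) (m n : nat) :
  (forall k, (m <= k < n)%N -> F T k @[T --> \oo] --> l k) ->
  \sum_(m <= k < n) F T k @[T --> \oo] --> \sum_(m <= k < n) l k.
Proof.
move=> H; rewrite [X in _ --> X]big_nat; under eq_cvg do rewrite big_nat.
by apply: cvg_big => //; exact: add_continuous.
Qed.

(** * The steady-state law and the two recurrences *)

Section Stationary.
Context {R : realType}.
Variables lam mu : nat -> R.
Hypothesis lam_gt0 : forall n, 0 < lam n.
Hypothesis mu_gt0 : forall n, (1 <= n)%N -> 0 < mu n.
Hypothesis potential_summable : cvgn (series (potential lam mu)).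

Lemma potential_gt0 n : 0 < potential lam mu n.
Proof.
by rewrite /potential divr_gt0 // prodr_gt0 // => i _; rewrite ?mu_gt0.
Qed.

Lemma potentialS n :
  mu n.+1 * potential lam mu n.+1 = lam n * potential lam mu n.
Proof.
rewrite /potential !big_ord_recr /= ; field.
by apply/andP; split; rewrite gt_eqF ?mu_gt0 // prodr_gt0 // => i _; rewrite mu_gt0.
Qed.

Lemma total_potential_gt0 : 0 < limn (series (potential lam mu)).
Proof.
apply: (@lt_le_trans _ _ (series (potential lam mu) 1)).
  by rewrite /series /= big_nat1 potential_gt0.
apply: nondecreasing_cvgn_le => //.
by apply: nondecreasing_series => i _ _; exact/ltW/potential_gt0.
Qed.

Lemma steady_gt0 n : 0 < steady lam mu n.
Proof. by rewrite divr_gt0 ?potential_gt0 ?total_potential_gt0. Qed.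

Lemma steady_balance n :
  mu n.+1 * steady lam mu n.+1 = lam n * steady lam mu n.
Proof. by rewrite /steady mulrA potentialS mulrA. Qed.

Lemma cvg_steady : series (steady lam mu) @ \oo --> (1 : R).
Proof.
have -> : series (steady lam mu) =
    (fun n => (limn (series (potential lam mu)))^-1 * series (potential lam mu) n).
  apply/funext => n; rewrite /series /= mulr_sumr.
  by apply: eq_bigr => i _; rewrite mulrC.
rewrite -[X in _ --> X](mulVf (lt0r_neq0 total_potential_gt0)).
by apply: cvgM; [exact: cvg_cst|].
Qed.

Lemma cvg_steady_resistance :
  series (fun n => 1 / (lam n * potential lam mu n)) @ \oo --> +oo ->
  series (fun n => (lam n * steady lam mu n)^-1) @ \oo --> +oo.
Proof.
move=> h; set Z := limn (series (potential lam mu)).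
have -> : series (fun n => (lam n * steady lam mu n)^-1) =
    (fun n => Z * series (fun n => 1 / (lam n * potential lam mu n)) n).
  apply/funext => n; rewrite /series /= mulr_sumr.
  apply: eq_bigr => i _; rewrite /steady -/Z; field.
  by rewrite !gt_eqF ?lam_gt0 ?potential_gt0 ?total_potential_gt0.
apply/cvgryPge => A; move/cvgryPge/(_ (A / Z)): h; apply: filterS => n.
by rewrite ler_pdivrMr ?total_potential_gt0// mulrC.
Qed.

Lemma steady_cdfE n : steady_cdf lam mu n = series (steady lam mu) n.+1.
Proof. by rewrite /steady_cdf /series /= big_mkord. Qed.

Lemma steady_cdfS n :
  steady_cdf lam mu n.+1 = steady_cdf lam mu n + steady lam mu n.+1.
Proof. by rewrite /steady_cdf big_ord_recr. Qed.

Lemma nondecreasing_steady_cdf : {homo steady_cdf lam mu : n m / (n <= m)%N >-> n <= m}.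
Proof.
apply/nondecreasing_seqP => n.
by rewrite steady_cdfS lerDl ltW ?steady_gt0.
Qed.

Lemma steady_cdf_gt0 n : 0 < steady_cdf lam mu n.
Proof.
apply: (@lt_le_trans _ _ (steady_cdf lam mu 0)).
  by rewrite /steady_cdf big_ord_recr big_ord0/= add0r steady_gt0.
exact: nondecreasing_steady_cdf.
Qed.

Lemma cvg_steady_cdf : steady_cdf lam mu @ \oo --> (1 : R).
Proof.
have -> : steady_cdf lam mu = (fun n => series (steady lam mu) n.+1).
  by apply/funext => n; rewrite steady_cdfE.
by rewrite (cvg_shiftS (series (steady lam mu))); exact: cvg_steady.
Qed.

Lemma steady_cdf_le1 n : steady_cdf lam mu n <= 1.
Proof.
rewrite -(cvg_lim (@Rhausdorff R) cvg_steady_cdf).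
apply: nondecreasing_cvgn_le; first exact: nondecreasing_steady_cdf.
by apply/cvg_ex; exists 1; exact: cvg_steady_cdf.
Qed.

Lemma steady_tail_ge0 n : 0 <= steady_tail lam mu n.
Proof. by rewrite subr_ge0 steady_cdf_le1. Qed.

Lemma cvg_steady_tail : steady_tail lam mu @ \oo --> (0 : R).
Proof.
rewrite -[X in _ --> X](subrr (1 : R)).
by apply: cvgB; [exact: cvg_cst|exact: cvg_steady_cdf].
Qed.

(** The ratio is below 1 exactly when the tail is below the cdf. This persists as the cdf grows, and
    it occurs because the tail vanishes. *)
Lemma ltn_split_phi n :
  (n < split_phi lam mu)%N = (steady_cdf lam mu n <= steady_tail lam mu n).
Proof.
have tail_lt k : (steady_tail lam mu k / steady_cdf lam mu k < 1) =
    (steady_tail lam mu k < steady_cdf lam mu k).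
  by rewrite ltr_pdivrMr ?steady_cdf_gt0// mul1r.
have up k l : (k <= l)%N -> steady_tail lam mu k / steady_cdf lam mu k < 1 ->
    steady_tail lam mu l / steady_cdf lam mu l < 1.
  rewrite !tail_lt => /nondecreasing_steady_cdf; rewrite /steady_tail; lra.
have ex : exists k, steady_tail lam mu k / steady_cdf lam mu k < 1.
  (* Tail and cdf add up to 1, so a tail below one half is smaller than the cdf. *)
  have /cvgr_lt/(_ 2^-1) := cvg_steady_tail.
  case=> [|N _ /(_ N (leqnn N)) /= hN]; first by rewrite invr_gt0.
  by exists N; rewrite tail_lt; rewrite /steady_tail in hN *; lra.
have E := lt_least _ n up ex; rewrite leNgt -tail_lt.
by apply/idP/idP => [/E.1/negP//|/negP]; exact: E.2.
Qed.

(** [up_mean n] and [down_mean n] turn out to be the mean passage times from [n] to [n.+1] and back;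
    see [mean_hitting_up] and [mean_hitting_down]. *)
Definition up_mean (n : nat) : R :=
  steady_cdf lam mu n / (lam n * steady lam mu n).

Definition down_mean (n : nat) : R :=
  steady_tail lam mu n / (lam n * steady lam mu n).

Lemma flow_gt0 n : 0 < lam n * steady lam mu n.
Proof. by rewrite mulr_gt0 ?steady_gt0. Qed.

Lemma up_mean_gt0 n : 0 < up_mean n.
Proof. by rewrite divr_gt0 ?steady_cdf_gt0 ?flow_gt0. Qed.

(** * Closed forms and errors of the two recurrences *)

Section Recurrences.
Variable c : nat -> R.

Lemma forwardE z n : lam n * steady lam mu n * forward lam mu c z n =
  \sum_(j < n.+1) steady lam mu j * (z - c j).
Proof.
elim: n => [|n IH] /=.
  by rewrite big_ord_recr big_ord0/= add0r; field; rewrite gt_eqF.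
rewrite big_ord_recr -IH -(steady_balance n) /=; field; by rewrite gt_eqF.
Qed.

Lemma forward_diff z z' n :
  forward lam mu c z n - forward lam mu c z' n = up_mean n * (z - z').
Proof.
apply: (mulfI (lt0r_neq0 (flow_gt0 n))).
rewrite mulrBr !forwardE -sumrB /up_mean.
rewrite [RHS](_ : _ = steady_cdf lam mu n * (z - z')); last first.
  by field; rewrite !gt_eqF ?steady_gt0.
by rewrite mulr_suml; apply: eq_bigr => i _; ring.
Qed.

(** The terminal index is written [n + k] so that the induction runs on the distance [k] to it, with
    [n] free; balance turns each backward step into the addition of one term. *)
Lemma backwardE z (phiN : nat -> nat -> R) n k :
  backward_recurrence lam mu c z phiN ->
  lam n * steady lam mu n * phiN (n + k)%N n =
  \sum_(j < k) steady lam mu (n.+1 + j) * (c (n.+1 + j)%N - z)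
  + lam (n + k)%N * steady lam mu (n + k) * phiN (n + k)%N (n + k)%N.
Proof.
move=> hb; elim: k n => [|k IH] n; first by rewrite big_ord0 add0r addn0.
rewrite big_ord_recl /= addn0.
have := hb (n + k.+1)%N n.+1; rewrite /= => ->; last by lia.
have := IH n.+1; rewrite addSnnS => H.
under eq_bigr do rewrite /bump /= add1n -addSnnS.
rewrite -addrA -H -(steady_balance n); field; by rewrite gt_eqF // mu_gt0.
Qed.

Hypothesis cost_summable : cvgn (series (fun n => `|c n| * steady lam mu n)).

Lemma cvg_mean_cost :
  series (fun n => c n * steady lam mu n) @ \oo --> mean_cost lam mu c.
Proof.
apply: normed_cvg; rewrite /normed_series_of /=.
by under eq_fun do rewrite normrM (gtr0_norm (steady_gt0 _)).
Qed.

(** The full series of p_j (zeta - c_j) is zero, so the exact value is also a sum over j > n. The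
    backward limit is that sum with z in place of zeta, and the difference is the tail mass times z
    - zeta. *)
Lemma cvg_backward_diff z (phiN : nat -> nat -> R) n :
  backward_recurrence lam mu c z phiN ->
  lam N * steady lam mu N * phiN N N @[N --> \oo] --> 0 ->
  phiN N n @[N --> \oo] -->
    forward lam mu c (mean_cost lam mu c) n - down_mean n * (z - mean_cost lam mu c).
Proof.
move=> hb ht; set zeta := mean_cost lam mu c; rewrite -(cvg_shiftn n (phiN^~ n)) /=.
(* [S k] is the partial sum of p_j (c_j - z); the sum in [backwardE] is a difference of two of its
   values. *)
pose S k := series (fun j => c j * steady lam mu j) k - z * series (steady lam mu) k.
have cS : S @ \oo --> zeta - z * 1.
  apply: cvgB; first exact: cvg_mean_cost.
  by apply: cvgM; [exact: cvg_cst|exact: cvg_steady].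
have E k : phiN (k + n)%N n = (lam n * steady lam mu n)^-1 *
    (S (k + n).+1 - S n.+1 + lam (k + n)%N * steady lam mu (k + n) * phiN (k + n)%N (k + n)%N).
  apply: (mulfI (lt0r_neq0 (flow_gt0 n))).
  rewrite mulVKf ?lt0r_neq0 ?flow_gt0// addnC (backwardE z)//; congr (_ + _).
  rewrite /S; elim: k => [|k IH]; first by rewrite big_ord0 addn0 subrr.
  rewrite big_ord_recr /= IH addnS !seriesSr -addSn addSn; ring.
under eq_fun do rewrite E.
have -> : forward lam mu c zeta n - down_mean n * (z - zeta) =
  (lam n * steady lam mu n)^-1 * (zeta - z * 1 - S n.+1 + 0).
  apply: (mulfI (lt0r_neq0 (flow_gt0 n))).
  rewrite mulVKf ?lt0r_neq0 ?flow_gt0// mulrBr forwardE.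
  rewrite /S /down_mean /steady_tail steady_cdfE.
  rewrite [X in _ - X](_ : _ = (1 - series (steady lam mu) n.+1) * (z - zeta)); last first.
    by field; rewrite !gt_eqF ?steady_gt0.
  have -> : \sum_(j < n.+1) steady lam mu j * (zeta - c j) =
     zeta * series (steady lam mu) n.+1 - series (fun j => c j * steady lam mu j) n.+1.
    rewrite /series /= !big_mkord mulr_sumr -sumrB; apply: eq_bigr => i _; ring.
  ring.
apply: cvgM; first exact: cvg_cst.
apply: cvgD.
  apply: cvgB; last exact: cvg_cst.
  under eq_fun do rewrite -addnS.
  by have := cS; rewrite -(cvg_shiftn n.+1 S).
by have := ht; rewrite -(cvg_shiftn n (fun N => lam N * steady lam mu N * phiN N N)).
Qed.

End Recurrences.


(** * Crossing of the upward and downward passage sums *)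

Lemma down_mean_lt_up_mean n :
  (down_mean n < up_mean n) = (steady_tail lam mu n < steady_cdf lam mu n).
Proof. by rewrite ltr_pM2r // invr_gt0 flow_gt0. Qed.

(** The sign of [up_mean - down_mean] is that of cdf minus tail, a nondecreasing sequence. A
    positive sum contains a positive term, after which all terms are positive, so the inequality is
    never undone. *)
Lemma sum_down_lt_sum_up n m : (n <= m)%N ->
  \sum_(j < n) down_mean j < \sum_(j < n) up_mean j ->
  \sum_(j < m) down_mean j < \sum_(j < m) up_mean j.
Proof.
move=> nm lt_n; have [j jn lt_j] : exists2 j, (j < n)%N & down_mean j < up_mean j.
  apply: contrapT => H; move: lt_n; apply/negP; rewrite -leNgt.
  apply: ler_sum => j _; rewrite leNgt; apply/negP => lt_j; apply: H.
  by exists j.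
elim: m nm => [|m IH]; first by rewrite leqn0 => /eqP n0; rewrite n0 in lt_n.
rewrite leq_eqVlt => /predU1P[<-//|]; rewrite ltnS => nm.
rewrite !big_ord_recr/= ltrD ?IH//.
move: lt_j; rewrite !down_mean_lt_up_mean /steady_tail => lt_j.
have := @nondecreasing_steady_cdf j m (leq_trans (ltnW jn) nm); lra.
Qed.

Hypothesis resistance_diverges :
  series (fun n => 1 / (lam n * potential lam mu n)) @ \oo --> +oo.

Lemma ex_sum_down_lt_sum_up :
  exists2 n, (1 <= n)%N & \sum_(j < n) down_mean j < \sum_(j < n) up_mean j.
Proof.
set r := fun n => (lam n * steady lam mu n)^-1.
(* A tail below 1/4 leaves cdf minus tail above 1/2, so from [N] on each step adds at least half a
   resistance [r] to [D]. *)
have [N _ hN] : \forall n \near \oo, steady_tail lam mu n < 4^-1.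
  by apply: (cvgr_lt _ cvg_steady_tail); rewrite invr_gt0.
pose D n := \sum_(j < n) up_mean j - \sum_(j < n) down_mean j.
have grow k : D N + 2^-1 * (series r (N + k)%N - series r N) <= D (N + k)%N.
  elim: k => [|k IH]; first by rewrite addn0 subrr mulr0 addr0.
  rewrite addnS seriesSr /D !big_ord_recr /= -/(up_mean _) -/(D _).
  have /hN /= : (N <= N + k)%N by rewrite leq_addr.
  have r_gt0 : 0 < r (N + k)%N by rewrite invr_gt0 flow_gt0.
  move: IH; rewrite /D /up_mean /down_mean -/(r _) /steady_tail => IH tl; nra.
(* This threshold is what makes the lower bound in [grow] reach 1. *)
have /cvgryPge/(_ (series r N + 2 * (1 - D N))) : series r @ \oo --> +oo.
  exact: cvg_steady_resistance.
case=> n0 _ /(_ (N + n0.+1)%N (leq_trans (leqnSn n0) (leq_addl _ _))) /= big.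
exists (N + n0.+1)%N; first by rewrite addnS.
by have := grow n0.+1; rewrite -subr_gt0 -/(D _); lra.
Qed.

(** * The truncated hitting-time equations *)

(** With [u = 0] this is the classical first-step equation for mean hitting times; [u] corrects for
    the truncation at a finite horizon. *)
Definition hitting_balance (U u : nat -> R) (i : nat) : Prop :=
  u i = 1 - (lam i + mu i) * U i + lam i * U i.+1 + mu i * U i.-1.

(** * Upward passages *)

Section Up.
Hypothesis mu0 : mu 0%N = 0.

(** Weighted by p_i, the equation is a difference of consecutive fluxes. Summation starts at 0,
    where [mu 0 = 0] removes the boundary flux and the junk neighbour [0.-1]. *)
Lemma up_increment (U u : nat -> R) n :
  (forall i, (i < n)%N -> hitting_balance U u i) -> forall i, (i < n)%N ->
  lam i * steady lam mu i * (U i - U i.+1) =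
  \sum_(j < i.+1) steady lam mu j * (1 - u j).
Proof.
move=> H; elim=> [|i IH] lt_in.
  by rewrite big_ord_recr big_ord0 /= H// mu0; ring.
rewrite big_ord_recr /= -IH 1?ltnW// H// -(steady_balance i) /=; ring.
Qed.

Variables (n : nat) (U u : nat -> nat -> R).
Hypothesis balU : forall T i, (i < n)%N -> hitting_balance (U T) (u T) i.
Hypothesis Un : forall T, U T n = 0.
Hypothesis u01 : forall T i, 0 <= u T i <= 1.
Hypothesis uU : forall T i, T%:R * u T i <= U T i.

(** As [u] is nonnegative, [U] is bounded uniformly in [T]; then [T * u <= U] forces [u] to 0, and
    the increments converge. *)
Lemma cvg_up_mean i : (i <= n)%N ->
  U T i @[T --> \oo] --> \sum_(i <= k < n) up_mean k.
Proof.
move=> le_in.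
have UE T j : (j <= n)%N -> U T j = \sum_(j <= k < n) (U T k - U T k.+1).
  move=> jn; have := telescope_sumr (fun k => - U T k) jn.
  rewrite Un oppr0 sub0r opprK => <-; apply: eq_bigr => k _; ring.
have inc T k : (k < n)%N -> U T k - U T k.+1 =
    (lam k * steady lam mu k)^-1 * \sum_(j < k.+1) steady lam mu j * (1 - u T j).
  move=> kn; rewrite -(@up_increment (U T) (u T) n (balU T) k kn).
  by rewrite mulKf // lt0r_neq0 // flow_gt0.
have U_le T j : (j <= n)%N -> U T j <= \sum_(j <= k < n) up_mean k.
  move=> jn; rewrite UE//; apply: ler_sum_nat => k /andP[_ kn].
  rewrite inc// mulrC /up_mean ler_pM2r ?invr_gt0 ?flow_gt0//.
  apply: ler_sum => l _; rewrite ler_piMr ?(ltW (steady_gt0 _))//.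
  by have := u01 T l; lra.
have u0 j : (j <= n)%N -> u T j @[T --> \oo] --> 0.
  (* The shift to [T.+1] allows division by the horizon. *)
  move=> jn; rewrite -(cvg_shiftS (u^~ j)).
  apply: (@squeeze_cvgr _ _ _ _ (fun=> 0) (fun T => (\sum_(j <= k < n) up_mean k) * T.+1%:R^-1)).
  - apply: nearW => T; have /andP[-> _] /= := u01 T.+1 j.
    by rewrite ler_pdivlMr// mulrC (le_trans (uU _ _)) ?U_le.
  - exact: cvg_cst.
  - rewrite -[X in _ --> X](mulr0 (\sum_(j <= k < n) up_mean k)).
    by apply: cvgM; [exact: cvg_cst|exact: cvg_harmonic].
under eq_cvg do rewrite UE//.
apply: cvg_sum_nat => k /andP[_ kn]; under eq_cvg do rewrite inc//.
rewrite /up_mean mulrC; apply: cvgM; first exact: cvg_cst.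
under eq_cvg do rewrite -(big_mkord xpredT (fun j => steady lam mu j * (1 - u _ j))).
rewrite /steady_cdf -(big_mkord xpredT (steady lam mu)).
apply: cvg_sum_nat => j /andP[_ jk].
rewrite -[X in _ --> X](_ : steady lam mu j * (1 - 0) = _); last by rewrite subr0 mulr1.
apply: cvgM; first exact: cvg_cst.
by apply: cvgB; [exact: cvg_cst|apply: u0; exact: ltnW (leq_trans jk kn)].
Qed.

End Up.

(* The drift w would make U grow like w * sum 1 / (lam_k p_k). *)
Lemma bounded_flow (U : nat -> R) (w B : R) i : 0 < w ->
  (forall k, (i <= k)%N -> w <= lam k * steady lam mu k * (U k.+1 - U k)) ->
  (forall k, U k <= B) -> False.
Proof.
move=> w0 hw hB; set r := fun n => (lam n * steady lam mu n)^-1.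
have grow k : U i + w * (series r (i + k)%N - series r i) <= U (i + k)%N.
  elim: k => [|k IH]; first by rewrite addn0 subrr mulr0 addr0.
  rewrite addnS seriesSr /=; have := hw (i + k)%N (leq_addr _ _).
  by rewrite mulrC -ler_pdivrMr ?flow_gt0// -/(r _) => ?; lra.
have /cvgryPge/(_ (series r i + (B - U i + 1) / w)) : series r @ \oo --> +oo.
  exact: cvg_steady_resistance.
case=> n0 _ /(_ (i + n0)%N (leq_addl _ _)) /=.
rewrite -lerBrDl ler_pdivrMr// mulrC => h.
by have := grow n0; have := hB (i + n0)%N; lra.
Qed.

(** * Downward passages *)

Section Down.

Lemma down_increment (U u : nat -> R) n :
  (forall i, (n < i)%N -> hitting_balance U u i) -> forall i k, (n <= i)%N ->
  lam i * steady lam mu i * (U i.+1 - U i) =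
  \sum_(i.+1 <= j < (i + k).+1) steady lam mu j * (1 - u j)
  + lam (i + k)%N * steady lam mu (i + k)%N * (U (i + k).+1 - U (i + k)%N).
Proof.
move=> H i; elim=> [|k IH] ni; first by rewrite addn0 big_geq// add0r.
rewrite IH// addnS [in RHS]big_nat_recr /=; last by rewrite ltnS leq_addr.
rewrite -addrA; congr (_ + _); rewrite H ?ltnS ?(leq_trans ni) ?leq_addr//.
rewrite -(steady_balance (i + k)) /=; ring.
Qed.

(** The flux [W] is nonincreasing. A negative value would persist and drive [U] to minus infinity; a
    value above the tail mass would leave a positive flux forever and drive [U] above [B]. Both
    contradict [bounded_flow]. *)
Lemma down_increment_bounds (U u : nat -> R) n B :
  (forall i, (n < i)%N -> hitting_balance U u i) ->
  (forall i, 0 <= u i <= 1) -> (forall i, 0 <= U i <= B) ->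
  forall i J, (n <= i)%N -> (i <= J)%N ->
  \sum_(i.+1 <= j < J.+1) steady lam mu j * (1 - u j)
    <= lam i * steady lam mu i * (U i.+1 - U i) <= steady_tail lam mu i.
Proof.
move=> H u01 UB i J ni iJ.
set W := fun i => lam i * steady lam mu i * (U i.+1 - U i).
have WE j k : (n <= j)%N ->
    W j = \sum_(j.+1 <= l < (j + k).+1) steady lam mu l * (1 - u l) + W (j + k)%N.
  by move=> nj; rewrite /W -(down_increment U u n H).
have term_ge0 l : 0 <= steady lam mu l * (1 - u l).
  by rewrite mulr_ge0 ?(ltW (steady_gt0 _))//; have := u01 l; lra.
have W_ge0 j : (n <= j)%N -> 0 <= W j.
  move=> nj; rewrite leNgt; apply/negP => Wj.
  apply: (@bounded_flow (fun k => - U k) (- W j) 0 j); first lra.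
    move=> k jk; rewrite -opprD mulrN lerN2 -/(W k) (WE j (k - j)%N nj) subnKC//.
    by rewrite lerDr sumr_ge0.
  by move=> k; have := UB k; lra.
rewrite -/(W i); apply/andP; split.
  by rewrite (WE i (J - i)%N ni) subnKC// lerDl W_ge0// (leq_trans ni).
rewrite leNgt; apply/negP => lt_W.
apply: (@bounded_flow U (W i - steady_tail lam mu i) B i); first lra.
  move=> k ik; rewrite -/(W k) (WE i (k - i)%N ni) subnKC//.
  have : \sum_(i.+1 <= l < k.+1) steady lam mu l * (1 - u l) <=
         \sum_(i.+1 <= l < k.+1) steady lam mu l.
    apply: ler_sum => l _; rewrite ler_piMr ?(ltW (steady_gt0 _))//.
    by have := u01 l; lra.
  have : \sum_(i.+1 <= l < k.+1) steady lam mu l = steady_cdf lam mu k - steady_cdf lam mu i.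
    by rewrite !steady_cdfE sub_series_geq.
  by have := steady_cdf_le1 k; rewrite /steady_tail; lra.
by move=> k; have := UB k; lra.
Qed.

Variables (n : nat) (U u : nat -> nat -> R).
Hypothesis balU : forall T i, (n < i)%N -> hitting_balance (U T) (u T) i.
Hypothesis Un : forall T, U T n = 0.
Hypothesis u01 : forall T i, 0 <= u T i <= 1.
Hypothesis U0T : forall T i, 0 <= U T i <= T%:R.
Hypothesis uU : forall T i, T%:R * u T i <= U T i.

(** The a priori bound on [U] grows with [T], but the upper bound that [down_increment_bounds] draws
    from it does not, so [u] vanishes as for upward passages. *)
Lemma cvg_down_mean i : (n <= i)%N ->
  U T i @[T --> \oo] --> \sum_(n <= k < i) down_mean k.
Proof.
move=> le_ni.
have bnd T := @down_increment_bounds (U T) (u T) n T%:R (balU T) (u01 T) (U0T T).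
have UE T j : (n <= j)%N -> U T j = \sum_(n <= k < j) (U T k.+1 - U T k).
  by move=> jn; rewrite telescope_sumr// Un subr0.
have U_le T j : (n <= j)%N -> U T j <= \sum_(n <= k < j) down_mean k.
  move=> jn; rewrite UE//; apply: ler_sum_nat => k /andP[nk _].
  rewrite /down_mean ler_pdivlMr ?flow_gt0// mulrC.
  by have /andP[] := bnd T k k nk (leqnn k).
have u0 j : (n <= j)%N -> u T j @[T --> \oo] --> 0.
  move=> jn; rewrite -(cvg_shiftS (u^~ j)).
  apply: (@squeeze_cvgr _ _ _ _ (fun=> 0) (fun T => (\sum_(n <= k < j) down_mean k) * T.+1%:R^-1)).
  - apply: nearW => T; have /andP[-> _] /= := u01 T.+1 j.
    by rewrite ler_pdivlMr// mulrC (le_trans (uU _ _)) ?U_le.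
  - exact: cvg_cst.
  - rewrite -[X in _ --> X](mulr0 (\sum_(n <= k < j) down_mean k)).
    by apply: cvgM; [exact: cvg_cst|exact: cvg_harmonic].
have incr k : (n <= k)%N -> (U T k.+1 - U T k) @[T --> \oo] --> down_mean k.
  move=> nk.
  suff cW : lam k * steady lam mu k * (U T k.+1 - U T k) @[T --> \oo] --> steady_tail lam mu k.
    under eq_cvg do rewrite -(mulKf (lt0r_neq0 (flow_gt0 k)) (U _ _ - _)).
    by rewrite /down_mean mulrC; apply: cvgM; [exact: cvg_cst|].
  apply/cvgrPdist_le => e e0.
  (* Half of [e] covers the mass beyond [J], uniformly in [T]; the other half covers the finitely
     many terms p_j u_j up to [J], which vanish as [T] grows. *)
  have e2 : 0 < e / 2 by rewrite divr_gt0.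
  have [J0 _ /(_ (J0 + k)%N (leq_addr _ _)) /= hJ] :
      \forall J \near \oo, steady_tail lam mu J < e / 2.
    exact: (cvgr_lt _ cvg_steady_tail).
  set J := (J0 + k)%N in hJ.
  have kJ : (k <= J)%N by rewrite leq_addl.
  have cS : \sum_(k.+1 <= j < J.+1) steady lam mu j * u T j @[T --> \oo] --> 0.
    rewrite -[X in _ --> X](_ : \sum_(k.+1 <= j < J.+1) steady lam mu j * 0 = _); last first.
      by rewrite big1// => ? _; rewrite mulr0.
    apply: cvg_sum_nat => j /andP[kj _]; apply: cvgM; first exact: cvg_cst.
    by apply: u0; rewrite (leq_trans nk)// ltnW.
  near=> T.
  have hT : \sum_(k.+1 <= j < J.+1) steady lam mu j * u T j < e / 2.
    by near: T; exact: (cvgr_lt _ cS).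
  have /andP[lo hi] := bnd T k J nk kJ.
  rewrite ger0_norm ?subr_ge0//.
  have E : \sum_(k.+1 <= j < J.+1) steady lam mu j * (1 - u T j) =
     steady_cdf lam mu J - steady_cdf lam mu k - \sum_(k.+1 <= j < J.+1) steady lam mu j * u T j.
    rewrite !steady_cdfE sub_series_geq// -sumrB; apply: eq_bigr => j _; ring.
  rewrite E in lo.
  by rewrite /steady_tail in hJ lo *; lra.
under eq_cvg do rewrite UE//.
by apply: cvg_sum_nat => k /andP[nk _]; exact: incr.
Unshelve. all: end_near. Qed.

End Down.

End Stationary.

(** * The chain sampled on a grid *)

Section FineProbability.
Context {d : measure_display} {T : measurableType d} {R : realType}.
Variable P : probability T R.
Implicit Types A B : set T.

Lemma fine_probability A : measurable A -> (fine (P A))%:E = P A.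
Proof. by move=> mA; rewrite fineK// fin_num_measure. Qed.

Lemma fine_probability_ge0 A : 0 <= fine (P A).
Proof. by rewrite fine_ge0. Qed.

Lemma fine_probability_le1 A : measurable A -> fine (P A) <= 1.
Proof. by move=> mA; rewrite -lee_fin fine_probability// probability_le1. Qed.

Lemma le_fine_probability A B : measurable A -> measurable B -> A `<=` B ->
  fine (P A) <= fine (P B).
Proof.
by move=> mA mB AB; rewrite -lee_fin !fine_probability// le_measure// inE.
Qed.

Lemma fine_probability_split A B : measurable A -> measurable B ->
  fine (P A) = fine (P (A `&` B)) + fine (P (A `&` ~` B)).
Proof.
move=> mA mB; apply: EFin_inj; rewrite EFinD !fine_probability//.
- by rewrite (measureDI P mA mB) addeC setDE.
- by apply: measurableI => //; exact: measurableC.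
- exact: measurableI.
Qed.

Lemma probability_setIr A B : measurable A -> measurable B -> P B = 1%E ->
  P (A `&` B) = P A.
Proof.
move=> mA mB PB; have mCB : measurable (~` B) by exact: measurableC.
have mAB : measurable (A `&` B) by exact: measurableI.
rewrite -[LHS]fine_probability// -[RHS]fine_probability//; congr (_%:E).
have E0 : fine (P (A `&` ~` B)) = 0.
  have le0 : fine (P (A `&` ~` B)) <= fine (P (~` B)).
    by apply: le_fine_probability => //; exact: measurableI.
  apply/eqP; rewrite eq_le fine_probability_ge0 andbT (le_trans le0)//.
  by rewrite probability_setC// PB subee.
by rewrite [RHS](fine_probability_split _ B mA mB) E0 addr0.
Qed.

Lemma measurable_notin (Z : T -> nat) (ys : seq nat) :
  (forall y, measurable [set w | Z w = y]) -> measurable [set w | Z w \notin ys].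
Proof.
move=> mZ.
rewrite (_ : [set w | _] = \bigcap_(z in [set` ys]) ~` [set w | Z w = z]).
  by apply: bigcap_measurableType => z _; apply: measurableC.
apply/seteqP; split => w /= h; first by move=> z zys Zz; rewrite Zz zys in h.
by apply/negP => Zys; exact: (h _ Zys).
Qed.

(** Only finitely many values are listed because a short step reaches states other than the current
    one and its neighbours with probability o(h); those are lumped into the remainder. *)
Lemma fine_probability_partition (Z : T -> nat) A (ys : seq nat) :
  (forall y, measurable [set w | Z w = y]) -> measurable A -> uniq ys ->
  fine (P A) = \sum_(y <- ys) fine (P (A `&` [set w | Z w = y]))
             + fine (P (A `&` [set w | Z w \notin ys])).
Proof.
move=> mZ mA; elim: ys => [_|y ys IH /= /andP[yys uys]].
  by rewrite big_nil add0r; congr (fine (P _)); apply/seteqP; split => [w|w []].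
have mN : measurable [set w | Z w \notin ys] by exact: measurable_notin.
rewrite big_cons IH// -addrA addrCA; congr (_ + _).
rewrite (fine_probability_split (A `&` [set w | Z w \notin ys]) [set w | Z w = y])//;
  last exact: measurableI.
congr (fine (P _) + fine (P _)); apply/seteqP; split => w /=.
- by move=> [[]].
- by move=> [Aw Zw]; split=> //; split=> //; rewrite Zw.
- by move=> [[Aw Zw] /eqP Zy]; split=> //; rewrite inE negb_or Zy.
- by rewrite inE negb_or => -[Aw /andP[/eqP Zy Zys]].
Qed.

End FineProbability.

Lemma integral_cst_probability {d : measure_display} {T : measurableType d} {R : realType}
    (P : probability T R) (r : R) :
  (\int[P]_w (cst r%:E) w = r%:E)%E.
Proof.
transitivity (r%:E * P setT)%E; first exact: integral_cst.
by rewrite probability_setT mule1.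
Qed.

(** * Dyadic grids, which divide every integer horizon into whole steps *)

Section Dyadic.
Context {R : realType}.

Definition dyadic (k : nat) : R := 2 ^- k.

Definition dyadic_steps (T k : nat) : nat := (T * 2 ^ k)%N.

Lemma dyadic_gt0 k : 0 < dyadic k.
Proof. by rewrite invr_gt0 exprn_gt0. Qed.

Lemma dyadic_stepsE T k : (dyadic_steps T k)%:R * dyadic k = T%:R.
Proof. by rewrite /dyadic_steps natrM natrX mulfK// expf_neq0. Qed.

Lemma cvg_dyadic : dyadic @ \oo --> 0.
Proof.
have := @cvg_geometric R 1 2^-1; rewrite /geometric /= => H.
under eq_cvg do rewrite /dyadic -exprVn -[_ ^+ _]mul1r.
by apply: H; rewrite ger0_norm ?invr_ge0// invf_lt1// ltr1n.
Qed.

Lemma cvg_along_dyadic (f : R -> R) (l : R) :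
  f x @[x --> 0^'+] --> l -> f (dyadic k) @[k --> \oo] --> l.
Proof.
move/cvg_at_rightP; apply; split; [exact: dyadic_gt0|exact: cvg_dyadic].
Qed.

End Dyadic.

Section Chain.
Context {R : realType} {d : measure_display} {Omega : measurableType d}.
Variables (lam mu : nat -> R) (Pr : nat -> probability Omega R) (X : R -> Omega -> nat).
Hypothesis hX : birth_death_chain Pr X lam mu.

Lemma measurable_state t n : 0 <= t -> measurable [set w | X t w = n].
Proof.
move=> t0; have mn : measurable ([set n] : set nat) by [].
by have := bd_measurable hX t0 measurableT mn; rewrite setTI.
Qed.

Definition path_event (t : nat -> R) (x : nat -> nat) (k : nat) : set Omega :=
  [set w | forall j, (j <= k)%N -> X (t j) w = x j].

Lemma measurable_path t x k : (forall j, 0 <= t j) -> measurable (path_event t x k).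
Proof.
move=> t0; rewrite (_ : path_event t x k =
  \bigcap_(j in [set j | (j <= k)%N]) [set w | X (t j) w = x j]) //.
by apply: bigcap_measurableType => j _; exact: measurable_state.
Qed.

Variable a : nat.

(** * Avoidance probabilities on a fixed grid *)

Section Grid.
Variable h : R.
Hypothesis h_gt0 : 0 < h.

Let grid_ge0 j : 0 <= j%:R * h.
Proof. by rewrite mulr_ge0// ltW. Qed.

Definition avoid_from (k l : nat) : set Omega :=
  [set w | forall j, (j <= l)%N -> X ((k + j)%:R * h) w != a].

Definition avoid l := avoid_from 0 l.

Lemma measurable_avoid_from k l : measurable (avoid_from k l).
Proof.
rewrite (_ : avoid_from k l =
  \bigcap_(j in [set j | (j <= l)%N]) ~` [set w | X ((k + j)%:R * h) w = a]).
  by apply: bigcap_measurableType => j _; apply/measurableC/measurable_state.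
by apply/seteqP; split => w /= H j /H => [/eqP|/eqP].
Qed.

(** The sum runs over all states, since the chain may move arbitrarily far within one step; in
    [\bar R] this nonnegative series needs no summability argument. *)
Fixpoint avoid_prob (r x : nat) : \bar R :=
  if x == a then 0%E else
  if r is r'.+1 then (\sum_(0 <= y <oo) Pr x [set w | X h w = y] * avoid_prob r' y)%E
  else 1%E.

Lemma avoid_prob_ge0 r x : (0 <= avoid_prob r x)%E.
Proof.
elim: r x => [|r IH] x /=; case: ifP => // _.
by apply: nneseries_ge0 => y _ _; rewrite mule_ge0.
Qed.

(** [bd_markov] handles a fully specified past and a single future state. Splitting over the next
    state [y] and appending it to the past extends it, by induction on [r], to avoidance over [r]
    further steps. *)
Lemma markov_avoid r i k (x : nat -> nat) :
  Pr i (path_event (fun j => j%:R * h) x k `&` avoid_from k r) =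
  (Pr i (path_event (fun j => j%:R * h)%R x k) * avoid_prob r (x k))%E.
Proof.
elim: r k x => [|r IH] k x; rewrite [avoid_prob _ _]/=; case: ifP => [/eqP xk|/negbT xk].
- rewrite mule0 (_ : _ `&` _ = set0) ?measure0//; apply/seteqP; split => // w /= [].
  by move=> /(_ k (leqnn k)) Xk /(_ 0%N isT); rewrite addn0 Xk xk eqxx.
- rewrite mule1; congr (Pr i _); apply/seteqP; split => [w []//|w /= Xw]; split=> // j.
  by rewrite leqn0 => /eqP ->; rewrite addn0 Xw.
- rewrite mule0 (_ : _ `&` _ = set0) ?measure0//; apply/seteqP; split => // w /= [].
  by move=> /(_ k (leqnn k)) Xk /(_ 0%N isT); rewrite addn0 Xk xk eqxx.
pose x' y j := if (j <= k)%N then x j else y.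
have x'S y : path_event (fun j => j%:R * h) (x' y) k.+1 =
    path_event (fun j => j%:R * h) x k `&` [set w | X (k%:R * h + h) w = y].
  have kS : k.+1%:R * h = k%:R * h + h by rewrite -addn1 natrD mulrDl mul1r.
  apply/seteqP; split => w /=.
    move=> H; split; last by have := H k.+1 (leqnn _); rewrite /x' ltnn kS.
    by move=> j jk; rewrite H ?(leqW jk)// /x' jk.
  move=> [H1 H2] j; rewrite leq_eqVlt /x' => /predU1P[->|]; first by rewrite ltnn kS.
  by rewrite ltnS => jk; rewrite jk H1.
have -> : path_event (fun j => j%:R * h) x k `&` avoid_from k r.+1 =
    \bigcup_(y in [set: nat]) (path_event (fun j => j%:R * h) (x' y) k.+1 `&` avoid_from k.+1 r).
  apply/seteqP; split => w /=.
    move=> [Hx Ha]; exists (X (k%:R * h + h) w) => //; split; first by rewrite x'S.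
    by move=> j jr; rewrite addSnnS; apply: Ha.
  move=> [y _ []]; rewrite x'S => -[Hx Hy] Ha; split=> // -[_|j jr].
    by rewrite addn0 Hx.
  by rewrite -addSnnS; apply: Ha.
rewrite measure_bigcup//; last first.
- move=> y z _ _ [w [[]]]; rewrite !x'S => -[_ /= <-] _ [[_ /= <-] _] //.
- by move=> y _; apply: measurableI; [exact: measurable_path|exact: measurable_avoid_from].
have term y : Pr i (path_event (fun j => j%:R * h) (x' y) k.+1 `&` avoid_from k.+1 r) =
    ((fine (Pr i (path_event (fun j => j%:R * h)%R x k)))%:E *
     (Pr (x k) [set w | X h w = y] * avoid_prob r y))%E.
  rewrite IH x'S (bd_markov hX)//; [|by move=> j _; rewrite ler_pM2r// ler_nat|exact: ltW].
  by rewrite /x' ltnn -muleA fine_probability//; exact: measurable_path.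
rewrite (eq_eseriesr (fun y _ => term y)).
rewrite nneseriesZl => [|y _]; last by rewrite mule_ge0// avoid_prob_ge0.
rewrite fine_probability; last exact: measurable_path.
by congr (_ * _)%E; apply: eq_eseriesl => y; rewrite /= in_setT.
Qed.

Lemma start_prob i : Pr i [set w | X 0 w = i] = 1%E.
Proof. exact: bd_start hX i. Qed.

Lemma avoidE l i : Pr i (avoid l) = avoid_prob l i.
Proof.
have E : path_event (fun j => j%:R * h) (fun=> i) 0 = [set w | X 0 w = i].
  apply/seteqP; split => w /=; first by move=> /(_ 0%N isT); rewrite mul0r.
  by move=> Xw j; rewrite leqn0 => /eqP ->; rewrite mul0r.
have := markov_avoid l i 0 (fun=> i); rewrite E start_prob mul1e => <-.
rewrite setIC probability_setIr ?start_prob//; first exact: measurable_avoid_from.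
exact: measurable_state.
Qed.

(** The past is the two-point path [i, y], whose first condition has full probability. Time 0
    belongs to [avoid], whence [i != a]. *)
Lemma avoid_step l i y : i != a ->
  Pr i (avoid l.+1 `&` [set w | X h w = y]) =
  (Pr i [set w | X h w = y] * Pr y (avoid l))%E.
Proof.
move=> ia; have m0 : measurable [set w | X 0 w = i] by exact: measurable_state.
have mh : measurable [set w | X h w = y] by apply/measurable_state/ltW.
pose x j := if (j == 0)%N then i else y.
have E : path_event (fun j => j%:R * h) x 1 = [set w | X h w = y] `&` [set w | X 0 w = i].
  apply/seteqP; split => w /=.
    by move=> H; split; [have := H 1%N isT; rewrite mul1r|have := H 0%N isT; rewrite mul0r].
  by move=> [H1 H0] [_|[_|//]]; rewrite ?mul0r ?mul1r.
have := markov_avoid l i 1 x.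
rewrite E (probability_setIr (Pr i) _ _ mh m0 (start_prob i)) /= -avoidE => <-.
rewrite -(probability_setIr _ (avoid l.+1 `&` _) _ _ m0) ?start_prob//; last first.
  by apply: measurableI => //; exact: measurable_avoid_from.
congr (Pr i _); apply/seteqP; split => w /=.
  move=> [[Ha Xh] X0]; split=> // j jl; exact: (Ha j.+1).
move=> [[Xh X0] Ha]; split=> //; split=> // -[_|j jl]; last exact: Ha.
by rewrite mul0r X0.
Qed.

Definition surv (i l : nat) : R := fine (Pr i (avoid l)).
Definition trans (i y : nat) : R := fine (Pr i [set w | X h w = y]).

Lemma surv_ge0 i l : 0 <= surv i l. Proof. exact: fine_probability_ge0. Qed.

Lemma surv_le1 i l : surv i l <= 1.
Proof. by apply: fine_probability_le1; exact: measurable_avoid_from. Qed.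

Lemma surv_target l : surv a l = 0.
Proof. by rewrite /surv avoidE; case: l => [|l] /=; rewrite eqxx. Qed.

Lemma surv0 i : i != a -> surv i 0 = 1.
Proof. by move=> ia; rewrite /surv avoidE /= (negbTE ia). Qed.

Lemma surv_anti i k l : (k <= l)%N -> surv i l <= surv i k.
Proof.
move=> kl; apply: le_fine_probability; try exact: measurable_avoid_from.
by move=> w H j jk; apply: H; exact: leq_trans kl.
Qed.

(** Survival through states outside [ys] lies between 0 and the probability of stepping outside
    [ys]. *)
Lemma surv_step i l (ys : seq nat) : i != a -> uniq ys ->
  \sum_(y <- ys) trans i y * surv y l <= surv i l.+1 <=
  \sum_(y <- ys) trans i y * surv y l + (1 - \sum_(y <- ys) trans i y).
Proof.
move=> ia uys; have mh y : measurable [set w | X h w = y] by apply/measurable_state/ltW.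
have mav := measurable_avoid_from 0 l.+1.
have mN : measurable [set w | X h w \notin ys] by exact: measurable_notin.
have -> : surv i l.+1 = \sum_(y <- ys) trans i y * surv y l +
    fine (Pr i (avoid l.+1 `&` [set w | X h w \notin ys])).
  rewrite {1}/surv (fine_probability_partition (Pr i) (X h) (avoid l.+1) ys)//.
  congr (_ + _); apply: eq_bigr => y _; rewrite avoid_step// fineM// fin_num_measure//.
  exact: measurable_avoid_from.
have := fine_probability_partition (Pr i) (X h) setT ys mh measurableT uys.
rewrite probability_setT [fine 1]/= setTI.
under eq_bigr do rewrite setTI -/(trans i _).
move=> E1; rewrite lerDl fine_probability_ge0 lerD2l /= {1}E1 addrAC subrr add0r.
by apply: le_fine_probability => //; exact: measurableI.
Qed.

(** Left Riemann sum of the survival function on [0, m h], approximating E_i[min(tau, m h)]. *)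
Definition riemann (m i : nat) : R := h * \sum_(l < m) surv i l.

Lemma riemann_target m : riemann m a = 0.
Proof. by rewrite /riemann big1 ?mulr0// => l _; exact: surv_target. Qed.

Lemma surv_le_riemann m i : m%:R * h * surv i m <= riemann m i.
Proof.
rewrite [m%:R * h]mulrC -mulrA ler_pM2l//.
have -> : m%:R * surv i m = \sum_(l < m) surv i m by rewrite sumr_const card_ord mulr_natl.
by apply: ler_sum => l _; apply: surv_anti; exact: ltnW.
Qed.

Lemma riemann_step m i (ys : seq nat) : i != a -> uniq ys ->
  `|riemann m i + h * surv i m - h - \sum_(y <- ys) trans i y * riemann m y|
    <= m%:R * h * (1 - \sum_(y <- ys) trans i y).
Proof.
move=> ia uys.
have E : riemann m i + h * surv i m - h = h * \sum_(l < m) surv i l.+1.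
  rewrite /riemann -mulrDr -[X in _ - X]mulr1 -mulrBr -[X in _ - X](surv0 _ ia); congr (_ * _).
  have -> : \sum_(l < m) surv i l + surv i m = \sum_(l < m.+1) surv i l by rewrite big_ord_recr.
  by rewrite big_ord_recl /= addrC addKr.
have -> : \sum_(y <- ys) trans i y * riemann m y =
    h * \sum_(l < m) \sum_(y <- ys) trans i y * surv y l.
  rewrite exchange_big /= mulr_sumr; apply: eq_bigr => y _.
  by rewrite /riemann -mulr_sumr mulrCA.
rewrite E -mulrBr -sumrB ger0_norm; last first.
  rewrite mulr_ge0 ?(ltW h_gt0)// sumr_ge0// => l _; rewrite subr_ge0.
  by have /andP[] := surv_step i l ys ia uys.
rewrite [m%:R * h]mulrC -mulrA ler_pM2l//.
set q := 1 - _; have -> : m%:R * q = \sum_(l < m) q by rewrite sumr_const card_ord mulr_natl.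
apply: ler_sum => l _; have /andP[_] := surv_step i l ys ia uys; rewrite /q; lra.
Qed.

End Grid.


(** * From the grid to the hitting time *)

Section Riemann.
Variable h : R.
Hypothesis h_gt0 : 0 < h.

(* Grid time spent before the first visit to the target, capped at m * h. *)
Definition occupation (m : nat) (w : Omega) : R :=
  h * \sum_(l < m) \1_(avoid h l) w.

Lemma occupation_ge0 m w : 0 <= occupation m w.
Proof. by rewrite mulr_ge0 ?(ltW h_gt0)// sumr_ge0. Qed.

Lemma occupation_le m w : occupation m w <= m%:R * h.
Proof.
rewrite [leRHS]mulrC ler_pM2l//.
have -> : m%:R = \sum_(l < m) 1 :> R by rewrite sumr_const card_ord.
by apply: ler_sum => l _; rewrite indicE; case: (_ \in _).
Qed.

Lemma occupation_le_hit m w j : X (j%:R * h) w = a -> occupation m w <= j%:R * h.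
Proof.
move=> Xj; have [mj|/ltnW jm] := leqP m j.
  by apply: (le_trans (occupation_le m w)); rewrite ler_pM2r// ler_nat.
rewrite [leRHS]mulrC ler_pM2l//.
have -> : j%:R = \sum_(l < j) 1 :> R by rewrite sumr_const card_ord.
rewrite (big_ord_widen m (fun=> 1) jm) [leRHS]big_mkcond /=.
apply: ler_sum => l _; rewrite indicE; case: ifPn => [_|]; first by case: (_ \in _).
rewrite -leqNgt => jl; rewrite memNset//= => H; have := H j jl.
by rewrite add0n Xj eqxx.
Qed.

Lemma occupation_ge m w q : (q <= m)%N ->
  (forall j, (j < q)%N -> X (j%:R * h) w != a) -> q%:R * h <= occupation m w.
Proof.
move=> qm H; rewrite [leLHS]mulrC ler_pM2l//.
have -> : q%:R = \sum_(l < q) 1 :> R by rewrite sumr_const card_ord.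
rewrite (big_ord_widen m (fun=> 1) qm) [leLHS]big_mkcond /=.
apply: ler_sum => l _; rewrite indicE; case: ifPn => [lq|//].
by rewrite mem_set//= => j jl; apply: H; exact: leq_ltn_trans lq.
Qed.

(** The first grid visit cannot precede the hitting time, and if no grid visit occurs before step
    [m] the occupation reaches its cap. *)
Lemma hitting_le_occupation m w :
  (mine (hitting_time X a w) (m%:R * h)%:E <= (occupation m w)%:E)%E.
Proof.
have [[j jm Xj]|noj] := pselect (exists2 j, (j < m)%N & X (j%:R * h) w == a).
  have exj : exists j, (j < m)%N && (X (j%:R * h) w == a) by exists j; rewrite jm.
  case: (ex_minnP exj) => q /andP[qm /eqP Xq] qmin.
  rewrite ge_min; apply/orP; left; apply: (@le_trans _ _ (q%:R * h)%:E).
    apply: ereal_inf_lbound; exists (q%:R * h) => //; split=> //.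
    by rewrite mulr_ge0// ltW.
  rewrite lee_fin occupation_ge ?(ltnW qm)// => l lq; apply/negP => Xl.
  by have := qmin l; rewrite (ltn_trans lq qm) Xl leqNgt lq => /(_ isT).
rewrite ge_min; apply/orP; right; rewrite lee_fin occupation_ge// => l lm.
by apply/negP => Xl; apply: noj; exists l.
Qed.

Lemma measurable_occupation m : measurable_fun setT (occupation m).
Proof.
apply: measurable_funM; first exact: measurable_cst.
by apply: measurable_sum => l; apply: measurable_indic; exact: measurable_avoid_from.
Qed.

Lemma integral_occupation m i :
  (\int[Pr i]_w (occupation m w)%:E = (riemann h m i)%:E)%E.
Proof.
have mi l : measurable_fun setT ((fun w => (\1_(avoid h l) w)%:E) : Omega -> \bar R).
  by apply/measurable_EFinP/measurable_indic; exact: measurable_avoid_from.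
under eq_integral do rewrite /occupation EFinM -sumEFin.
rewrite ge0_integralZl//; first last.
- by rewrite lee_fin ltW.
- by move=> w _; apply: sume_ge0 => l _; rewrite lee_fin.
- by apply: emeasurable_sum => l; exact: mi.
rewrite ge0_integral_sum//.
rewrite /riemann EFinM -sumEFin; congr (_ * _)%E; apply: eq_bigr => l _.
have mA : measurable (avoid h l) by exact: measurable_avoid_from.
by rewrite integral_indic// setIT fine_probability.
Qed.

End Riemann.

Local Notation grid := (@dyadic R).
Local Notation steps := dyadic_steps.
Let grid_gt0 k : 0 < grid k := dyadic_gt0 k.

Lemma hitting_time_ge0 w : (0 <= hitting_time X a w)%E.
Proof. by apply: le_ereal_inf_tmp => _ [t [t0 _] <-]; rewrite lee_fin. Qed.

Lemma fin_min_hitting T w : mine (hitting_time X a w) T%:R%:E \is a fin_num.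
Proof.
rewrite fin_numElt lt_min (lt_le_trans _ (hitting_time_ge0 w)) ?ltNyr//=.
by rewrite gt_min ltry orbT.
Qed.

(* Right-continuity makes a visit to the target last for a positive time, so
   that fine enough dyadic grids see it. *)
Lemma cvg_occupation T w :
  (occupation (grid k) (steps T k) w)%:E @[k --> \oo]
    --> mine (hitting_time X a w) T%:R%:E.
Proof.
have [M M_def] : exists M : R, mine (hitting_time X a w) T%:R%:E = M%:E.
  by exists (fine (mine (hitting_time X a w) T%:R%:E)); rewrite fineK ?fin_min_hitting.
rewrite M_def; apply: cvg_EFin; first exact: nearW.
have lo k : M <= occupation (grid k) (steps T k) w.
  by have := hitting_le_occupation _ (grid_gt0 k) (steps T k) w; rewrite dyadic_stepsE M_def lee_fin.
have hi k : occupation (grid k) (steps T k) w <= T%:R.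
  by rewrite -[leRHS](dyadic_stepsE T k) occupation_le.
have [tauT|Ttau] := ltP (hitting_time X a w) T%:R%:E; last first.
  have MT : M = T%:R by apply: EFin_inj; rewrite -M_def; apply/min_idPr.
  apply: cvg_near_cst; apply: nearW => k /=.
  by apply/eqP; rewrite eq_le {1}MT hi lo.
have Mtau : hitting_time X a w = M%:E by rewrite -M_def; apply/esym/min_idPl/ltW.
apply/cvgrPdist_le => e e0; have e2 : 0 < e / 2 by rewrite divr_gt0.
have : (hitting_time X a w < (M + e / 2)%:E)%E by rewrite Mtau lte_fin ltrDl.
move=> /ereal_inf_lt[_ [s [s0 Xs] <-]]; rewrite lte_fin => sM.
have [r /= r0 Hr] := bd_right_continuous hX w s0.
near=> k.
have kr : grid k < r by near: k; exact: (cvgr_lt _ cvg_dyadic).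
have ke : grid k < e / 2 by near: k; exact: (cvgr_lt _ cvg_dyadic).
have g0 := grid_gt0 k.
(* The first grid point after [s] lies within one step of it, hence still in the interval where the
   path stays at the target. *)
have /truncn_itv/andP[] : 0 <= s / grid k by rewrite divr_ge0// ltW.
set j := Num.trunc _; rewrite ler_pdivlMr// ltr_pdivrMr// => js sj.
have jE : j.+1%:R * grid k = j%:R * grid k + grid k by rewrite -addn1 natrD mulrDl mul1r.
have Xj : X (j.+1%:R * grid k) w = a.
  rewrite -Xs; apply: Hr => //=; rewrite distrC ger0_norm ?subr_ge0 ?(ltW sj)//; lra.
have := occupation_le_hit _ g0 (steps T k) w _ Xj; have := lo k.
by move=> l1 l2 /=; rewrite distrC ger0_norm ?subr_ge0//; lra.
Unshelve. all: end_near. Qed.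

(** * Truncated mean hitting times *)

Definition truncated_mean (T i : nat) : R :=
  fine (\int[Pr i]_w mine (hitting_time X a w) T%:R%:E)%E.

(** The hitting time is an infimum over uncountably many times; measurability comes from the
    pointwise limit of grid occupations. *)
Lemma measurable_min_hitting (T : nat) :
  measurable_fun setT ((fun w => mine (hitting_time X a w) T%:R%:E) : Omega -> \bar R).
Proof.
apply: (emeasurable_fun_cvg (fun k w => (occupation (grid k) (steps T k) w)%:E)).
  by move=> k; apply/measurable_EFinP; exact: measurable_occupation.
by move=> w _; exact: cvg_occupation.
Qed.

Lemma truncated_meanE T i :
  (\int[Pr i]_w mine (hitting_time X a w) T%:R%:E)%E = (truncated_mean T i)%:E.
Proof.
rewrite /truncated_mean fineK// ge0_fin_numE; last first.
  by apply: integral_ge0 => w _; rewrite le_min hitting_time_ge0 lee_fin ler0n.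
apply: (@le_lt_trans _ _ (\int[Pr i]_w (cst T%:R%:E) w)%E).
  apply: ge0_le_integral => //=.
  - by move=> w _; rewrite le_min hitting_time_ge0 lee_fin ler0n.
  - exact: measurable_min_hitting.
  - by move=> w _; rewrite ge_min lexx orbT.
by rewrite integral_cst_probability ltry.
Qed.

Lemma cvg_riemann T i :
  riemann (grid k) (steps T k) i @[k --> \oo] --> truncated_mean T i.
Proof.
suff : (\int[Pr i]_w (occupation (grid k) (steps T k) w)%:E)%E @[k --> \oo]
    --> (truncated_mean T i)%:E.
  under eq_cvg do rewrite integral_occupation//.
  by move/fine_cvg.
rewrite -truncated_meanE.
apply: (@dominated_cvg _ _ _ _ _ measurableT _ _ (EFin \o cst T%:R)) => //.
- by move=> k; apply/measurable_EFinP; exact: measurable_occupation.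
- by move=> w _; exact: cvg_occupation.
- exact: finite_measure_integrable_cst.
- move=> k w _ /=; rewrite lee_fin ger0_norm ?occupation_ge0//.
  by rewrite -(dyadic_stepsE T k) occupation_le.
Qed.

Lemma truncated_mean_ge0 T i : 0 <= truncated_mean T i.
Proof.
by apply: fine_ge0; apply: integral_ge0 => w _; rewrite le_min hitting_time_ge0 lee_fin ler0n.
Qed.

Lemma truncated_mean_le T i : truncated_mean T i <= T%:R.
Proof.
rewrite -lee_fin -truncated_meanE.
have {2}-> : (T%:R%:E = \int[Pr i]_w (cst T%:R%:E) w)%E.
  by rewrite integral_cst_probability.
apply: ge0_le_integral => //=.
- by move=> w _; rewrite le_min hitting_time_ge0 lee_fin ler0n.
- exact: measurable_min_hitting.
- by move=> w _; rewrite ge_min lexx orbT.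
Qed.

Lemma truncated_mean_target T : truncated_mean T a = 0.
Proof.
have := cvg_riemann T a; under eq_cvg do rewrite riemann_target//.
by move/cvg_lim => <- //; rewrite lim_cst.
Qed.

Lemma cvg_truncated_mean i :
  (truncated_mean T i)%:E @[T --> \oo] --> mean_hitting Pr X i a.
Proof.
under eq_cvg do rewrite -truncated_meanE.
have -> : mean_hitting Pr X i a =
    (\int[Pr i]_w limn (fun T => mine (hitting_time X a w) T%:R%:E))%E.
  apply: eq_integral => w _; apply/esym/cvg_lim => //.
  case E : (hitting_time X a w) => [r| |].
  - apply: cvg_near_cst; exists (Num.trunc r).+1; first by [].
    by move=> T /= rT; apply/min_idPl; rewrite lee_fin (le_trans (ltW (truncnS_gt r)))// ler_nat.
  - under eq_cvg => T do rewrite (min_idPr (leey _)).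
    exact/cvgenyP.
  - by have := hitting_time_ge0 w; rewrite E.
apply: cvg_monotone_convergence => //.
- by move=> T; exact: measurable_min_hitting.
- by move=> T w _; rewrite le_min hitting_time_ge0 lee_fin ler0n.
- move=> w _ S T ST; rewrite le_min ge_min lexx /= ge_min lee_fin ler_nat ST orbT //.
Qed.

End Chain.
(** * Mean hitting times and the mixed scheme *)

Section HittingMeans.
Context {R : realType} {d : measure_display} {Omega : measurableType d}.
Variables (lam mu : nat -> R) (Pr : nat -> probability Omega R) (X : R -> Omega -> nat).
Hypothesis hX : birth_death_chain Pr X lam mu.
Hypothesis mu0 : mu 0%N = 0.

Section Target.
Variable a : nat.

Local Notation grid := (@dyadic R).
Local Notation steps := dyadic_steps.
Let grid_gt0 k : 0 < grid k := dyadic_gt0 k.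
Let U (T i : nat) : R := truncated_mean Pr X a T i.

(* This is the probability of not hitting the target up to time T; only its bounds
   and its balance equation are needed, so the latter serves as definition. *)
Definition late_survival (T i : nat) : R :=
  if i == a then 0
  else 1 - (lam i + mu i) * U T i + lam i * U T i.+1 + mu i * U T i.-1.

Let stay_rate i k := (1 - trans Pr X (grid k) i i) / grid k.
Let birth_rate i k := trans Pr X (grid k) i i.+1 / grid k.
(* The case i = 0 is apart because 0.-1 = 0 is not a neighbour of 0. *)
Let death_rate i k := if i is j.+1 then trans Pr X (grid k) i j / grid k else 0.

(** This is [riemann_step] divided by the step size, over [i] and its neighbours; state 0 has only
    one neighbour and is treated apart. *)
Lemma surv_approx T i k : i != a ->
  `|surv Pr X a (grid k) i (steps T k)
    - (1 - stay_rate i k * riemann Pr X a (grid k) (steps T k) i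
       + birth_rate i k * riemann Pr X a (grid k) (steps T k) i.+1
       + death_rate i k * riemann Pr X a (grid k) (steps T k) i.-1)|
  <= T%:R * (stay_rate i k - birth_rate i k - death_rate i k).
Proof.
move=> ia; have g0 := grid_gt0 k; have gN0 := lt0r_neq0 g0.
rewrite -(ler_pM2l g0) -{1}(gtr0_norm g0) -normrM.
case: i ia => [|i] ia.
  have := riemann_step _ _ _ _ hX a _ g0 (steps T k) 0%N [:: 0%N; 1%N] ia isT.
  rewrite dyadic_stepsE !big_cons !big_nil /= => H.
  apply: le_trans (le_trans H _).
    rewrite le_eqVlt; apply/orP; left; apply/eqP; congr (`|_|).
    by rewrite /stay_rate /birth_rate /death_rate; field.
  rewrite le_eqVlt; apply/orP; left; apply/eqP.
  by rewrite /stay_rate /birth_rate /death_rate; field.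
have uys : uniq [:: i; i.+1; i.+2] by rewrite /= !inE; lia.
have := riemann_step _ _ _ _ hX a _ g0 (steps T k) i.+1 _ ia uys.
rewrite dyadic_stepsE !big_cons !big_nil /= => H.
apply: le_trans (le_trans H _).
  rewrite le_eqVlt; apply/orP; left; apply/eqP; congr (`|_|).
  by rewrite /stay_rate /birth_rate /death_rate; field.
rewrite le_eqVlt; apply/orP; left; apply/eqP.
by rewrite /stay_rate /birth_rate /death_rate; field.
Qed.

(** The rate of leaving [i] is exhausted by the two neighbours, so the error in [surv_approx] tends
    to T (lam_i + mu_i - lam_i - mu_i) = 0. *)
Lemma cvg_surv T i : i != a ->
  surv Pr X a (grid k) i (steps T k) @[k --> \oo] --> late_survival T i.
Proof.
move=> ia; rewrite /late_survival (negbTE ia).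
have cs : stay_rate i @ \oo --> lam i + mu i.
  apply: (cvg_along_dyadic (fun h => (1 - fine (Pr i [set w | X h w = i])) / h)).
  exact: (bd_stay hX).
have cb : birth_rate i @ \oo --> lam i.
  apply: (cvg_along_dyadic (fun h => fine (Pr i [set w | X h w = i.+1]) / h)).
  exact: (bd_birth hX).
have cd : death_rate i @ \oo --> mu i.
  rewrite /death_rate; case: i {ia cs cb} => [|i]; first by rewrite mu0; exact: cvg_cst.
  apply: (cvg_along_dyadic (fun h => fine (Pr i.+1 [set w | X h w = i]) / h)).
  by exact: (bd_death hX).
have cR j := cvg_riemann _ _ _ _ hX a T j.
pose app k := 1 - stay_rate i k * riemann Pr X a (grid k) (steps T k) i
       + birth_rate i k * riemann Pr X a (grid k) (steps T k) i.+1
       + death_rate i k * riemann Pr X a (grid k) (steps T k) i.-1.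
pose err k := T%:R * (stay_rate i k - birth_rate i k - death_rate i k).
have capp : app @ \oo --> 1 - (lam i + mu i) * U T i + lam i * U T i.+1 + mu i * U T i.-1.
  apply: cvgD; last by apply: cvgM.
  apply: cvgD; last by apply: cvgM.
  by apply: cvgB; [exact: cvg_cst|apply: cvgM].
have cerr : err @ \oo --> 0.
  rewrite -[X in _ --> X](_ : T%:R * (lam i + mu i - lam i - mu i) = 0); last by ring.
  apply: cvgM; first exact: cvg_cst.
  by apply: cvgB => //; exact: cvgB.
apply: (@squeeze_cvgr _ _ _ _ (fun k => app k - err k) (fun k => app k + err k)).
- apply: nearW => k; have := surv_approx T i k ia.
  by rewrite ler_norml -/(app k) -/(err k) => /andP[? ?]; apply/andP; split; lra.
- by rewrite -[X in _ --> X]subr0; exact: cvgB.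
- by rewrite -[X in _ --> X]addr0; exact: cvgD.
Qed.

Lemma late_survival01 T i : 0 <= late_survival T i <= 1.
Proof.
have [ia|ia] := eqVneq i a; first by rewrite /late_survival ia eqxx lexx ler01.
have c := cvg_surv T i ia; have cc := cvgP _ c.
rewrite -(cvg_lim (@Rhausdorff R) c); apply/andP; split.
  by apply: limr_ge => //; apply: nearW => k; exact: surv_ge0.
by apply: limr_le => //; apply: nearW => k; exact: (surv_le1 _ _ _ _ hX a _ (grid_gt0 k)).
Qed.

Lemma late_survival_le T i : T%:R * late_survival T i <= U T i.
Proof.
have [ia|ia] := eqVneq i a.
  by rewrite /late_survival ia eqxx mulr0; exact: truncated_mean_ge0.
have c := cvg_surv T i ia.
have cT : T%:R * surv Pr X a (grid k) i (steps T k) @[k --> \oo] --> T%:R * late_survival T i.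
  by apply: cvgM; [exact: cvg_cst|].
have cU := cvg_riemann _ _ _ _ hX a T i.
rewrite -(cvg_lim (@Rhausdorff R) cT) /U -(cvg_lim (@Rhausdorff R) cU).
apply: ler_lim; [exact: cvgP cT|exact: cvgP cU|apply: nearW => k].
by rewrite -(dyadic_stepsE T k); exact: (surv_le_riemann _ _ _ _ hX a _ (grid_gt0 k)).
Qed.

Lemma late_survival_balance T i : i != a ->
  hitting_balance lam mu (U T) (late_survival T) i.
Proof. by move=> ia; rewrite /hitting_balance /late_survival (negbTE ia). Qed.

End Target.

Hypothesis lam_gt0 : forall n, 0 < lam n.
Hypothesis mu_gt0 : forall n, (1 <= n)%N -> 0 < mu n.
Hypothesis potential_summable : cvgn (series (potential lam mu)).
Hypothesis resistance_diverges :
  series (fun n => 1 / (lam n * potential lam mu n)) @ \oo --> +oo.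

Lemma mean_hitting_limit a i (l : R) :
  truncated_mean Pr X a T i @[T --> \oo] --> l -> mean_hitting Pr X i a = l%:E.
Proof.
move=> cl; have := cvg_truncated_mean _ _ _ _ hX a i; move/cvg_lim => <- //.
by apply/cvg_lim => //; apply: cvg_EFin; [exact: nearW|].
Qed.

Lemma mean_hitting_up i n : (i <= n)%N ->
  mean_hitting Pr X i n = (\sum_(i <= k < n) up_mean lam mu k)%:E.
Proof.
move=> le_in; apply: mean_hitting_limit.
apply: (cvg_up_mean _ _ lam_gt0 mu_gt0 potential_summable mu0 n _ (late_survival n)) => //.
- by move=> T j jn; apply: late_survival_balance; rewrite ltn_eqF.
- by move=> T; exact: truncated_mean_target hX _ _.
- exact: late_survival01.
- exact: late_survival_le.
Qed.

Lemma mean_hitting_down i n : (n <= i)%N ->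
  mean_hitting Pr X i n = (\sum_(n <= k < i) down_mean lam mu k)%:E.
Proof.
move=> le_in; apply: mean_hitting_limit.
apply: (cvg_down_mean _ _ lam_gt0 mu_gt0 potential_summable resistance_diverges n
  _ (late_survival n)) => //.
- by move=> T j jn; apply: late_survival_balance; rewrite gtn_eqF.
- by move=> T; exact: truncated_mean_target hX _ _.
- exact: late_survival01.
- by move=> T j; rewrite truncated_mean_ge0 (truncated_mean_le _ _ _ _ hX).
- exact: late_survival_le.
Qed.

Lemma coef_A_mean n : coef_A Pr X lam mu n =
  (if (n < split_phi lam mu)%N then up_mean lam mu n else - down_mean lam mu n)%:E.
Proof.
rewrite /coef_A; case: ifP => _; first by rewrite mean_hitting_up// big_nat1.
by rewrite mean_hitting_down// big_nat1.
Qed.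

Lemma ltn_split_b n :
  (n < split_b Pr X)%N = (mean_hitting Pr X 0 n <= mean_hitting Pr X n 0)%E.
Proof.
(* The equivalence includes [k = 0]: the left side fails by [1 <= k], the right side because both
   sums are empty. *)
have E k : ((1 <= k)%N /\ (mean_hitting Pr X k 0 / mean_hitting Pr X 0 k < 1)%E) <->
    \sum_(j < k) down_mean lam mu j < \sum_(j < k) up_mean lam mu j.
  rewrite (mean_hitting_up 0 k)// (mean_hitting_down k 0)// !big_mkord.
  case: k => [|k]; first by rewrite !big_ord0 ltxx; split => // -[].
  have up0 : 0 < \sum_(j < k.+1) up_mean lam mu j.
    rewrite big_ord_recr /= ltr_wpDl ?up_mean_gt0// sumr_ge0// => j _.
    exact/ltW/up_mean_gt0.
  by rewrite inver gt_eqF// lte_pdivrMr// mul1e lte_fin; split => [[]|].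
have up k l : (k <= l)%N ->
    ((1 <= k)%N /\ (mean_hitting Pr X k 0 / mean_hitting Pr X 0 k < 1)%E) ->
    ((1 <= l)%N /\ (mean_hitting Pr X l 0 / mean_hitting Pr X 0 l < 1)%E).
  by move=> kl; rewrite !E; exact: sum_down_lt_sum_up.
have ex : exists k, (1 <= k)%N /\ (mean_hitting Pr X k 0 / mean_hitting Pr X 0 k < 1)%E.
  have [k _ hk] := ex_sum_down_lt_sum_up _ _ lam_gt0 mu_gt0 potential_summable resistance_diverges.
  by exists k; apply/E.
have L := lt_least _ n up ex; move: L; rewrite /= E -/(split_b Pr X) => L.
rewrite (mean_hitting_up 0 n)// (mean_hitting_down n 0)// !big_mkord lee_fin leNgt.
by apply/idP/idP => [/L/negP//|/negP/L].
Qed.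

Lemma coef_B_mean n : coef_B Pr X n =
  (if (n < split_b Pr X)%N then \sum_(j < n) up_mean lam mu j
   else - \sum_(j < n) down_mean lam mu j)%:E.
Proof.
rewrite /coef_B; case: ifP => _.
  by rewrite (mean_hitting_up 0 n)// big_mkord.
by rewrite (mean_hitting_down n 0)// big_mkord.
Qed.

(** * Limits of the errors of the mixed scheme *)

Section Errors.
Variables (c : nat -> R) (b0 zetah : R) (phiN : nat -> nat -> R).
Hypothesis cost_summable : cvgn (series (fun n => `|c n| * steady lam mu n)).
Hypothesis hback : backward_recurrence lam mu c zetah phiN.
Hypothesis hterm : lam N * steady lam mu N * phiN N N @[N --> \oo] --> 0.
Let zeta := mean_cost lam mu c.

(** The branch depends on [n] alone: the forward error is constant in [N], and the backward error
    converges by [cvg_backward_diff]. *)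
Lemma cvg_abs_err_mixed_phi n :
  abs_err (mixed_phi lam mu c zetah phiN N n) (forward lam mu c zeta n)
    @[N --> \oo] -->
  (if (n < split_phi lam mu)%N then up_mean lam mu n else - down_mean lam mu n)
    * abs_err zetah zeta.
Proof.
rewrite /mixed_phi /abs_err ltn_split_phi//; case: ifP => _.
  by rewrite forward_diff//; exact: cvg_cst.
have := cvg_backward_diff _ _ lam_gt0 mu_gt0 potential_summable c
  cost_summable zetah phiN n hback hterm.
move=> /(cvgB (g := fun=> forward lam mu c zeta n))/(_ (cvg_cst _)).
by rewrite -/zeta addrAC subrr add0r mulNr.
Qed.

Lemma cvg_abs_err_mixed_b n :
  abs_err (mixed_b Pr X lam mu c b0 zetah phiN N n) (bias b0 (forward lam mu c zeta) n)
    @[N --> \oo] -->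
  (if (n < split_b Pr X)%N then \sum_(j < n) up_mean lam mu j
   else - \sum_(j < n) down_mean lam mu j) * abs_err zetah zeta.
Proof.
rewrite /mixed_b /abs_err ltn_split_b; case: ifP => _.
  rewrite /bias opprD addrACA subrr add0r -sumrB mulr_suml.
  by under eq_bigr do rewrite forward_diff//; exact: cvg_cst.
rewrite /bias; under eq_cvg do rewrite opprD addrACA subrr add0r -sumrB
  -(big_mkord xpredT (fun j => phiN _ j - forward lam mu c zeta j)).
rewrite -sumrN mulr_suml -(big_mkord xpredT (fun j => - down_mean lam mu j * (zetah - zeta))).
apply: cvg_sum_nat => j _.
have := cvg_backward_diff _ _ lam_gt0 mu_gt0 potential_summable c
  cost_summable zetah phiN j hback hterm.
move=> /(cvgB (g := fun=> forward lam mu c zeta j))/(_ (cvg_cst _)).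
by rewrite -/zeta addrAC subrr add0r mulNr.
Qed.

End Errors.

End HittingMeans.

(** The factor [zeta] cancels the denominator of the relative error of [zetah]. The limit is stated
    in [\bar R] because the coefficients are extended reals there. *)
Lemma cvg_rel_err (R : realType) (x : nat -> R) (y zetah zeta C : R) :
  abs_err (x N) y @[N --> \oo] --> C * abs_err zetah zeta ->
  zeta != 0 -> y != 0 ->
  (rel_err (x N) y)%:E @[N --> \oo]
    --> (zeta%:E * C%:E / y%:E * (rel_err zetah zeta)%:E)%E.
Proof.
move=> H z0 y0; rewrite inver (negbTE y0) -!EFinM; apply: cvg_EFin; first exact: nearW.
rewrite [X in _ --> X](_ : _ = C * abs_err zetah zeta / y); last first.
  by rewrite /rel_err; field; rewrite ?y0 ?z0.
by apply: cvgM => //; exact: cvg_cst.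
Qed.

Theorem proposition7p1 (R : realType) (lam mu c : nat -> R)
  (hlam : forall n, 0 < lam n)
  (hmu0 : mu 0%N = 0)
  (hmu : forall n, (1 <= n)%N -> 0 < mu n)
  (hrec : series (fun n => 1 / (lam n * potential lam mu n)) @ \oo --> +oo)
  (hsum : cvgn (series (potential lam mu)))
  (hc : cvgn (series (fun n => `|c n| * steady lam mu n)))
  (d : measure_display) (Omega : measurableType d)
  (Pr : nat -> probability Omega R) (X : R -> Omega -> nat)
  (hX : birth_death_chain Pr X lam mu)
  (b0 zetah : R) (phiN : nat -> nat -> R)
  (zeta := mean_cost lam mu c)
  (phi := forward lam mu c zeta)
  (b := bias b0 phi)
  (tphi := mixed_phi lam mu c zetah phiN)
  (tb := mixed_b Pr X lam mu c b0 zetah phiN)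
  (A := coef_A Pr X lam mu)
  (B := coef_B Pr X)
  (hzetah : zetah != zeta)
  (hback : backward_recurrence lam mu c zetah phiN)
  (hterm : lam N * steady lam mu N * phiN N N @[N --> \oo] --> 0)
  (n : nat) :
  [/\ (abs_err (tphi N n) (phi n))%:E @[N --> \oo]
        --> (A n * (abs_err zetah zeta)%:E)%E,
      zeta != 0 -> phi n != 0 ->
        (rel_err (tphi N n) (phi n))%:E @[N --> \oo]
          --> (zeta%:E * A n / (phi n)%:E * (rel_err zetah zeta)%:E)%E,
      (abs_err (tb N n) (b n))%:E @[N --> \oo]
        --> (B n * (abs_err zetah zeta)%:E)%E
    & zeta != 0 -> b n != 0 ->
        (rel_err (tb N n) (b n))%:E @[N --> \oo]
          --> (zeta%:E * B n / (b n)%:E * (rel_err zetah zeta)%:E)%E].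
Proof.
have hA := cvg_abs_err_mixed_phi lam mu hlam hmu hsum c zetah phiN hc hback hterm n.
have hB := cvg_abs_err_mixed_b lam mu Pr X hX hmu0 hlam hmu hsum hrec c b0 zetah
  phiN hc hback hterm n.
(* The mean hitting times are finite, so both coefficients become real numbers and the limits reduce
   to real ones. *)
rewrite /A /B (coef_A_mean lam mu Pr X hX hmu0 hlam hmu hsum hrec)
  (coef_B_mean lam mu Pr X hX hmu0 hlam hmu hsum hrec).
split.
- by apply: cvg_EFin; [exact: nearW|exact: hA].
- exact: cvg_rel_err hA.
- by apply: cvg_EFin; [exact: nearW|exact: hB].
- exact: cvg_rel_err hB.
Qed.
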